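(* Let $X$ be a real Banach space and let $f:X\rightarrow\mathbb{R}\cup\{+\infty\}$ be proper, quasiconvex and lower semicontinuous. Assume that for each $x\in X\setminus\operatorname{arg\,min} f$ there exists $\lambda<f(x)$ such that $\operatorname{int} S_\lambda\neq\emptyset$. Then there exists a norm-to-weak$^*$ upper semicontinuous set-valued map $A:X\setminus\operatorname{arg\,min} f\rightrightarrows B^*$ such that $A(x)$ is a weak$^*$ compact base of the cone $N^a(x)$, for all $x\in X\setminus\operatorname{arg\,min} f$.
   Context: $X$ is a real Banach space with norm $\|\cdot\|$, $X^*$ is its topological dual with dual norm $\|\cdot\|_*$, and $\langle\cdot,\cdot\rangle$ is the duality pairing between $X^*$ and $X$. $X$ carries the norm topology and $X^*$ the weak$^*$ topology. $B^*$ is the closed unit ball of $X^*$. For a nonempty $D\subseteq X$ and $x\in X$, $\operatorname{dist}(x,D)=\inf\{\|y-x\|:y\in D\}$, and for $r\ge 0$, $B(D,r)=\{x\in X:\operatorname{dist}(x,D)\le r\}$. For $f:X\to\mathbb{R}\cup\{+\infty\}$ and $\lambda\in\mathbb{R}\cup\{+\infty\}$, let $S_\lambda=\{x\in X:f(x)\le\lambda\}$ and $S^<_\lambda=\{x\in X:f(x)<\lambda\}$ (so $S_{\infty}=X$ and $S^<_{\infty}=\operatorname{dom} f$). The function $f$ is quasiconvex if $S_\lambda$ is convex for all $\lambda\in\mathbb{R}$. The set $\operatorname{arg\,min} f$ is the (possibly empty) set of global minimizers of $f$ on $X$. The adjusted sublevel set of $f$ at $x\in X$ is $S^a_f(x)=S_{f(x)}$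 if $x\in\operatorname{arg\,min} f$, and $S^a_f(x)=S_{f(x)}\cap B(S^<_{f(x)},\rho_x)$ with $\rho_x=\operatorname{dist}(x,S^<_{f(x)})$ if $x\notin\operatorname{arg\,min} f$. The normal operator $N^a:X\rightrightarrows X^*$ is $$N^a(x)=\{x^*\in X^*:\langle x^*,y-x\rangle\le 0,\ \forall y\in S^a_f(x)\}.$$ A subset $K\subseteq X^*$ is a cone if $tx^*\in K$ for each $x^*\in K$ and $t>0$. A convex subset $A$ of a cone $K$ is a base of $K$ if $K=\{tx^*:t\ge 0,\ x^*\in A\}$ and $0$ does not belong to the weak$^*$ closure of $A$. A set-valued map $\Phi:D\rightrightarrows X^*$ with $D\subseteq X$ is norm-to-weak$^*$ upper semicontinuous if for every $x\in D$ and every weak$^*$ open set $\Omega\subseteq X^*$ with $\Phi(x)\subseteq\Omega$ there exists a norm neighbourhood $U_x$ of $x$ in $D$ such that $\Phi(x')\subseteq\Omega$ for all $x'\in U_x$. *)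

(* Defs.v *)
From HB Require Import structures.
From mathcomp Require Import all_boot all_order all_algebra.
From mathcomp Require Import all_classical all_reals all_analysis.

Set Implicit Arguments.
Unset Strict Implicit.
Unset Printing Implicit Defensive.

Import Order.TTheory GRing.Theory Num.Theory.
Import numFieldNormedType.Exports.

Local Open Scope classical_set_scope.
Local Open Scope ring_scope.

Section TopologicalDual.
Context {R : realType} (X : normedModType R).

Definition lcfun : {pred X -> R^o} :=
  [pred u : X -> R^o | `[< linear u /\ continuous u >]].

Lemma lcfun_submod_closed : submod_closed lcfun.
Proof.
split=> [|a u v /asboolP[lu cu] /asboolP[lv cv]].
  apply/asboolP; split=> [a x y|]; last by move=> x; exact: cst_continuous.
  by rewrite (_ : 0 = cst 0 :> (X -> R^o))//= scaler0 addr0.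
apply/asboolP; split=> [b x y|].
  have E w : (a *: u + v) w = a *: u w + v w by [].
  by rewrite !E lu lv !scalerDr !scalerA [a * b]mulrC addrACA.
move=> x; apply: (@continuousD R R^o X); last exact: cv.
by apply: (@continuousZr R R^o X); exact: cu.
Qed.

HB.instance Definition _ :=
  GRing.isSubmodClosed.Build R (X -> R^o) lcfun lcfun_submod_closed.

Record dual := Dual { dual_fun :> X -> R^o ; _ : dual_fun \in lcfun }.

HB.instance Definition _ := [isSub for dual_fun].
HB.instance Definition _ := [Choice of dual by <:].
HB.instance Definition _ := [SubChoice_isSubLmodule of dual by <:].

(* The weak* topology is the topology of pointwise convergence. *)
HB.instance Definition _ := Topological.copy dual
  (initial_topology (dual_fun : dual -> {ptws X -> R})).

Lemma dual_linear (u : dual) : linear u.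
Proof. by case: u => u /= /asboolP[]. Qed.

Lemma dual_continuous (u : dual) : continuous u.
Proof. by case: u => u /= /asboolP[]. Qed.

HB.instance Definition _ (u : dual) :=
  GRing.isLinear.Build R X R^o *:%R (dual_fun u) (@dual_linear u).

Definition dual_norm (u : dual) : R :=
  sup [set `|u x| | x in [set x : X | `|x| <= 1]].

Lemma dual_norm_has_sup (u : dual) :
  has_sup [set `|u x| | x in [set x : X | `|x| <= 1]].
Proof.
split; first by exists `|u 0|, 0 => //=; rewrite normr0.
have /bounded_funP/(_ 1)[M uM] : bounded_near u (nbhs (0 : X)).
  by apply/linear_bounded_continuous; exact: dual_continuous.
by exists M => _ [x x1 <-]; exact: uM.
Qed.

Definition dual_unit_ball : set dual := [set u | dual_norm u <= 1].

End TopologicalDual.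

Arguments dual_unit_ball {R X}.

Section AdjustedSublevelSets.
Context {R : realType} {X : normedModType R}.
Implicit Types (D : set X) (f : X -> \bar R) (x : X).

(* Only meaningful for nonempty D. *)
Definition dist x D : R := inf [set `|y - x| | y in D].

Definition enlargement D (r : R) : set X := [set x | dist x D <= r].

Definition proper_fun f := (forall x, f x <> -oo%E) /\ exists x, (f x < +oo)%E.

Definition sublevel f (l : \bar R) : set X := [set x | (f x <= l)%E].

Definition strict_sublevel f (l : \bar R) : set X := [set x | (f x < l)%E].

Definition quasiconvex f := forall l : R, convex_set (sublevel f l%:E).

Definition argmin f : set X := [set x | forall y, (f x <= f y)%E].

(* When x is not a minimizer, [strict_sublevel f (f x)] is nonempty. *)
Definition adjusted_sublevel f x : set X :=
  if x \in argmin f then sublevel f (f x)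
  else let S := strict_sublevel f (f x) in
       sublevel f (f x) `&` enlargement S (dist x S).

Definition adjusted_normal f x : set (dual X) :=
  [set u | forall y, adjusted_sublevel f x y -> u (y - x) <= 0].

End AdjustedSublevelSets.

Section Cones.
Context {R : realType} {X : normedModType R}.
Implicit Types A K : set (dual X).

Definition cone K := forall (u : dual X) (t : R), K u -> 0 < t -> K (t *: u).

Definition cone_base A K := [/\ cone K, A `<=` K, convex_set A,
  K = [set v | exists t u, [/\ 0 <= t, A u & v = t *: u]] & ~ closure A 0].

End Cones.

(* Upper semicontinuity of the restriction of Phi to D, for the topology
   induced on D. *)
Definition upper_semicontinuous_on {T U : topologicalType} (D : set T)
    (Phi : T -> set U) :=
  forall x, D x -> forall O : set U, open O -> Phi x `<=` O ->
    \forall x' \near within D (nbhs x), Phi x' `<=` O.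

(* Main.v *)
(** If the closed ball of center [z] and radius [r] lies in a sublevel set [S_l]
    with [l < f x], then every [u] in [N^a(x)] satisfies [r ||u|| <= u (x - z)].
    Hence [A(x)], the set of the [u] in [N^a(x)] of norm at most 1 such that
    [r <= u (x - z)] for all such balls, contains every unit vector of [N^a(x)]
    and avoids a weak* neighborhood of 0. Being defined without any choice of
    [z], it needs no gluing: lower semicontinuity of [f] makes the constraints
    persist near [x], and every point of [S^a_f(x)] is a limit of points lying
    in [S^a_f(x')] for all [x'] near [x], so the graph of [A] is closed in
    [X \argmin f] times the weak* compact unit ball. That [N^a(x)] is not
    reduced to 0 is the Hahn-Banach theorem. *)

Require Import Defs.
From HB Require Import structures.
From mathcomp Require Import all_boot all_order all_algebra.
From mathcomp Require Import all_classical all_reals all_analysis.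
From mathcomp Require Import ring lra.

Set Implicit Arguments.
Unset Strict Implicit.
Unset Printing Implicit Defensive.

Import Order.TTheory GRing.Theory Num.Theory.
Import numFieldNormedType.Exports.

Local Open Scope classical_set_scope.
Local Open Scope ring_scope.

(** * Convex cones and separation by a continuous functional *)

Definition convex_cone (R : realFieldType) (V : lmodType R) (M : set V) :=
  [/\ M 0, forall v w, M v -> M w -> M (v + w)
    & forall t v, 0 <= t -> M v -> M (t *: v)].

Lemma convex_cone_adjoin (R : realFieldType) (V : lmodType R) (M : set V)
    (v : V) : convex_cone M ->
  convex_cone [set w | exists2 t, 0 <= t & M (w - t *: v)].
Proof.
move=> [M0 MD MZ]; split=> /=.
- by exists 0; rewrite // scale0r subr0.
- move=> w w' [t t0 Mw] [s s0 Mw']; exists (t + s); first exact: addr_ge0.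
  by rewrite scalerDl opprD addrACA; exact: MD.
- move=> s w s0 [t t0 Mw]; exists (s * t); first exact: mulr_ge0.
  by rewrite -scalerA -scalerBr; exact: MZ.
Qed.

(** Zorn's lemma gives [M] maximal among the convex cones containing [P] and avoiding [e]. If [M]
    missed both [v] and [- v], adjoining either one would capture [e]. *)
Lemma convex_cone_maximal (R : realFieldType) (V : lmodType R) (P : set V)
    (e : V) : convex_cone P -> ~ P e ->
  exists M : set V, [/\ convex_cone M, P `<=` M, ~ M e
    & forall v, M v \/ M (- v)].
Proof.
move=> cP Pe.
(* Joining [P] inside the predicate lets the empty chain, whose union is empty, satisfy [Q]. *)
pose Q (M : set V) := convex_cone (P `|` M) /\ ~ (P `|` M) e.
have [F FQ totF|M0 [[cM Me] maxM]] := @Zorn_bigcup V Q.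
  have in_chain v w : (P `|` \bigcup_(Y in F) Y) v ->
      (P `|` \bigcup_(Y in F) Y) w -> (P v /\ P w) \/
      exists2 Y, F Y & (P `|` Y) v /\ (P `|` Y) w.
    move=> [Pv|[Y FY Yv]] [Pw|[Z FZ Zw]]; first by left.
    - by right; exists Z => //; split; [left|right].
    - by right; exists Y => //; split; [right|left].
    - right; case: (totF _ _ FY FZ) => YZ.
        by exists Z => //; split; right; [exact: YZ|].
      by exists Y => //; split; right; [|exact: YZ].
  have [P0 PD PZ] := cP.
  split; last by move=> [//|[Y /FQ[_ YP] Ye]]; apply: YP; right.
  split; first by left.
  - move=> v w Uv Uw; have [[Pv Pw]|[Y FY [Yv Yw]]] := in_chain _ _ Uv Uw.
      by left; exact: PD.
    have [[_ YD _] _] := FQ _ FY.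
    by have [?|?] := YD _ _ Yv Yw; [left|right; exists Y].
  - move=> t v t0 [Pv|[Y FY Yv]]; first by left; exact: PZ.
    have [[_ _ YZ] _] := FQ _ FY.
    have [?|?] := YZ _ _ t0 (or_intror Yv); first by left.
    by right; exists Y.
set M := P `|` M0 in cM Me maxM.
have [M_0 MD MZ] := cM.
exists M; split=> //; first by move=> v; left.
have absorb v : ~ M v -> exists2 t, 0 <= t & M (e - t *: v).
  move=> Mv; apply: contrapT => Ne.
  pose M' := [set w | exists2 t, 0 <= t & M (w - t *: v)].
  have sMM' : M `<=` M' by move=> w Mw; exists 0; rewrite // scale0r subr0.
  have PM' : P `|` M' = M'.
    by apply/setUidPr => w Pw; apply: sMM'; left.
  apply: (maxM M'); last by split; rewrite PM' //; exact: convex_cone_adjoin.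
  split; first by move=> w M0w; apply: sMM'; right.
  move=> M'M0; apply: Mv; right; apply: M'M0.
  by exists 1; rewrite // scale1r subrr.
move=> v; apply: contrapT => /not_orP[/absorb[t t0 Mt] /absorb[s s0 Ms]].
have [ts0|ts0] := eqVneq (s + t) 0.
  apply: Me; move: Mt; have -> : t = 0 by apply/eqP; lra.
  by rewrite scale0r subr0.
(* The terms in [v] cancel in [s (e - t v) + t (e + s v) = (s + t) e]. *)
apply: Me; rewrite -[e]scale1r -(mulVf ts0) -scalerA.
apply: (MZ); first by rewrite invr_ge0 addr_ge0.
have -> : (s + t) *: e = s *: (e - t *: v) + t *: (e - s *: - v).
  rewrite !scalerBr scalerDl !scalerN opprK !scalerA mulrC.
  by rewrite addrACA [- _ + _]addrC subrr addr0.
by apply: MD; exact: MZ.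
Qed.

(* The functional sends [v] to the infimum of the [a] with [v - a e] in a
   maximal convex cone containing [P] but not [e]. *)
Lemma convex_cone_separation (R : realType) (X : normedModType R) (P : set X)
    (e : X) (r : R) : convex_cone P -> 0 < r ->
    (forall v, `|v| <= r -> P (v - e)) -> ~ P e ->
  exists u : dual X, (forall v, P v -> u v <= 0) /\ 0 < u e.
Proof.
move=> cP r0 Pr Pe; have [M [[M0 MD MZ] PM Me Mtot]] := 
  convex_cone_maximal cP Pe.
have MNe : M (- e) by apply: PM; rewrite -sub0r; apply: Pr; rewrite normr0 ltW.
pose D v := [set a | M (v - a *: e)].
(* [M] contains the ball of radius [r] centered at [- e]. The resulting bound, linear in the norm,
   makes the infimum finite and later gives continuity. *)
have Dnorm v : D v (`|v| / r).
  rewrite /D /=; have [->|v0] := eqVneq v 0.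
    by rewrite normr0 mul0r scale0r subr0.
  have v_gt0 : 0 < `|v| by rewrite normr_gt0.
  have -> : v - (`|v| / r) *: e = (`|v| / r) *: ((r / `|v|) *: v - e).
    rewrite scalerBr scalerA mulrA divfK ?gt_eqF// divff ?gt_eqF//.
    by rewrite scale1r.
  apply: MZ; first by rewrite divr_ge0// ltW.
  apply/PM/Pr; rewrite normrZ ger0_norm ?divr_ge0 ?(ltW r0)//.
  by rewrite divfK// gt_eqF.
have Dup v a b : D v a -> a <= b -> D v b.
  rewrite /D /= => Da ab.
  have -> : v - b *: e = (v - a *: e) + (b - a) *: (- e).
    by rewrite scalerN scalerBl opprB addrA subrK.
  by apply: MD => //; apply: MZ => //; rewrite subr_ge0.
have DD v w a b : D v a -> D w b -> D (v + w) (a + b).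
  by rewrite /D /= => Da Db; rewrite scalerDl opprD addrACA; exact: MD.
(* Totality of [M] enters here: it makes the subadditive [p] odd, hence additive. *)
have DN v a : ~ D v a -> D (- v) (- a).
  rewrite /D /= => Da; have [//|] := Mtot (v - a *: e).
  by rewrite opprB scaleNr opprK addrC.
have D0 a : D 0 a -> 0 <= a.
  rewrite /D /= sub0r -scalerN => Ma; rewrite leNgt; apply/negP => a0.
  apply: Me; rewrite -[e]scale1r -(mulVf (lt0r_neq0 (_ : 0 < - a))) ?oppr_gt0//.
  rewrite -scalerA; apply: MZ; first by rewrite invr_ge0 oppr_ge0 ltW.
  by rewrite scaleNr -scalerN.
have Dlb v : lbound (D v) (- (`|v| / r)).
  move=> a Da; rewrite -subr_ge0 opprK; apply: D0; rewrite -(subrr v).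
  by apply: DD => //; rewrite -normrN.
have Dinf v : has_inf (D v) by split; [exists (`|v| / r)|exists (- (`|v| / r))].
pose p v := inf (D v).
have pD v a : D v a -> p v <= a.
  by move=> Da; apply: ge_inf => //; case: (Dinf v).
have pP v a : p v < a -> D v a.
  by move=> /(inf_lt (proj1 (Dinf v)))[b Db ba]; apply: Dup Db (ltW ba).
have p_le v a : (forall b, a < b -> p v <= b) -> p v <= a.
  by move=> H; apply/ler_addgt0Pr => eps eps0; apply: H; rewrite ltrDl.
have padd v w : p (v + w) <= p v + p w.
  apply: p_le => b vwb; pose h := (b - p v - p w) / 2.
  have -> : b = (p v + h) + (p w + h) by rewrite /h; field.
  by apply/pD/DD; apply: pP; rewrite ltrDl /h; lra.
have p0 : p 0 = 0.
  apply/eqP; rewrite eq_le; apply/andP; split; last first.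
    by apply: lb_le_inf; [case: (Dinf 0)|move=> a /D0].
  by apply: pD; rewrite /D /= scale0r subr0.
have pN v : p (- v) = - p v.
  apply/eqP; rewrite eq_le; apply/andP; split; last first.
    by rewrite -subr_ge0 opprK -p0 -(subrr v) addrC.
  apply: p_le => b vb; rewrite -[b]opprK; apply/pD/DN => /pD; lra.
have padd_eq v w : p (v + w) = p v + p w.
  apply/eqP; rewrite eq_le padd /=.
  by have := padd (- v) (v + w); rewrite addKr pN; lra.
have pZ_le t v : 0 < t -> p (t *: v) <= t * p v.
  move=> t0; apply: p_le => b; rewrite mulrC -ltr_pdivlMr// => /pP Db.
  apply: pD; rewrite /D /=; have -> : t *: v - b *: e = t *: (v - (b / t) *: e).
    by rewrite scalerBr scalerA mulrC divfK// gt_eqF.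
  by apply: MZ => //; exact: ltW.
have pZ_gt t v : 0 < t -> p (t *: v) = t * p v.
  move=> t0; apply/eqP; rewrite eq_le pZ_le//=.
  have := pZ_le t^-1 (t *: v); rewrite invr_gt0 => /(_ t0).
  by rewrite scalerA mulVf ?gt_eqF// scale1r mulrC ler_pdivlMr// mulrC.
have pZ t v : p (t *: v) = t * p v.
  have [t0|t0|->] := ltgtP t 0; [|exact: pZ_gt|by rewrite !scale0r p0 mul0r].
  have := pZ_gt (- t) v; rewrite scaleNr pN mulNr oppr_gt0.
  by move=> /(_ t0)/oppr_inj.
have plin : linear (p : X -> R^o) by move=> a v w; rewrite padd_eq pZ.
pose L := GRing.isLinear.Build R X R^o *:%R (p : X -> R^o) plin.
pose pl : {linear X -> R^o} := HB.pack (p : X -> R^o) L.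
have pcont : continuous (p : X -> R^o).
  apply: (bounded_linear_continuous (f := pl)); apply/linear_boundedP.
  exists r^-1; split; first exact: num_real.
  move=> M1 rM1 v; rewrite /pl /=.
  have : `|p v| <= `|v| / r.
    by rewrite ler_norml pD ?andbT//; apply: lb_le_inf => //; case: (Dinf v).
  by move=> /le_trans; apply; rewrite mulrC ler_wpM2r// ltW.
have pin : (p : X -> R^o) \in @lcfun R X by apply/asboolP.
exists (Dual pin); split => [v Pv|] /=.
  by apply: pD; rewrite /D /= scale0r subr0; exact: PM.
(* Since [- e + e = 0] lies in [M], [p (- e) <= -1]. *)
rewrite -[p e]opprK -pN oppr_gt0 (le_lt_trans (_ : _ <= -1)) ?ltrN10//.
by apply: pD; rewrite /D /= scaleN1r subrr.
Qed.

(** * The dual norm and weak* compactness of the dual unit ball *)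

Section DualBall.
Context {R : realType} {X : normedModType R}.
Implicit Types (u : dual X) (v : X).

Lemma ler_dual_norm u v : `|u v| <= dual_norm u * `|v|.
Proof.
have [->|v0] := eqVneq v 0; first by rewrite linear0 !normr0 mulr0.
have v_gt0 : 0 < `|v| by rewrite normr_gt0.
rewrite -ler_pdivrMr// mulrC -[X in X * _]ger0_norm ?invr_ge0// -normrM.
have -> : `|v|^-1 * u v = u (`|v|^-1 *: v) by rewrite linearZ.
apply: (sup_upper_bound (dual_norm_has_sup u)); exists (`|v|^-1 *: v) => //=.
by rewrite normrZ normfV normr_id mulVf// gt_eqF.
Qed.

Lemma dual_norm_ge0 u : 0 <= dual_norm u.
Proof.
apply: (sup_upper_bound (dual_norm_has_sup u)); exists 0.
  by rewrite /= normr0.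
by rewrite linear0 normr0.
Qed.

Lemma dual_norm_le u (c : R) :
  (forall v, `|v| <= 1 -> `|u v| <= c) -> dual_norm u <= c.
Proof.
move=> uc; apply: ge_sup; first by case: (dual_norm_has_sup u).
by move=> _ [v /= v1 <-]; exact: uc.
Qed.

Lemma dual_unit_ballP u : dual_unit_ball u <-> forall v, `|u v| <= `|v|.
Proof.
split=> [u1 v|uv].
  by apply: le_trans (ler_dual_norm u v) _; rewrite ler_piMl.
by apply: dual_norm_le => v; exact: le_trans.
Qed.

Lemma continuous_ptws_eval v : continuous (fun g : {ptws X -> R} => g v).
Proof. exact: (@proj_continuous X (fun=> R) v). Qed.

Lemma continuous_dual_eval v : continuous (fun u : dual X => u v : R).
Proof.
move=> u; have ic : continuous (@dual_fun R X : dual X -> {ptws X -> R}).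
  exact: initial_continuous.
exact: (continuous_comp (ic u) (@continuous_ptws_eval v (dual_fun u))).
Qed.

(** Banach-Alaoglu: the ball embeds in a product of segments, compact by Tychonoff, and a cluster
    point there is again linear and bounded by the norm. *)
Lemma compact_dual_unit_ball : compact (dual_unit_ball : set (dual X)).
Proof.
move=> F PF Fball.
pose toF := @dual_fun R X : dual X -> {ptws X -> R}.
pose K := [set g : {ptws X -> R} | forall v, [set r : R | `|r| <= `|v|] (g v)].
have cK : compact K.
  apply: (@tychonoff X (fun=> R) (fun v => [set r : R | `|r| <= `|v|])) => v.
  rewrite (_ : mkset _ = `[- `|v|, `|v|]%classic); first exact: segment_compact.
  by apply/seteqP; split=> r /=; rewrite in_itv /= ler_norml.
have FK : F (toF @^-1` K).
  by apply: filterS Fball => u /dual_unit_ballP uv v; exact: uv.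
have [g [Kg clg]] := cK (toF @ F) _ FK.
have glin : linear (g : X -> R^o).
  move=> a v w.
  pose h (k : {ptws X -> R}) : R := k (a *: v + w) - (a * k v + k w).
  have hc : continuous h.
    move=> k; have ev y := @continuous_ptws_eval y k.
    exact: (cvgB (ev (a *: v + w)) (cvgD (cvgMl_tmp (ev v)) (ev w))).
  (* Linearity is a closed condition that holds on the image of the dual, hence at the cluster point
     [g]. *)
  have : closed [set k | h k = 0].
    by apply: (@preimage_closed _ _ h [set r | r = 0]) => //; exact: closed_eq.
  move=> /(_ g) hg; apply/eqP; rewrite -subr_eq0; apply/eqP; apply: hg.
  move=> B gB; apply: clg => //; apply: (@filterS _ F _ setT _) filterT.
  by move=> u _; rewrite /= /h /toF linearP subrr.
have gcont : continuous (g : X -> R^o).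
  pose L := GRing.isLinear.Build R X R^o *:%R (g : X -> R^o) glin.
  pose gl : {linear X -> R^o} := HB.pack (g : X -> R^o) L.
  apply: (bounded_linear_continuous (f := gl)); apply/linear_boundedP.
  exists 1; split => // M M1 v; apply: le_trans (Kg v) _.
  by rewrite ler_peMl// ltW.
have gin : (g : X -> R^o) \in @lcfun R X by apply/asboolP.
exists (Dual gin); split; first by apply/dual_unit_ballP.
(* Weak* open sets are preimages of pointwise open ones, so clustering at [g] pulls back to the
   dual. *)
move=> B C FB; rewrite nbhsE => -[_ [[U oU <-] Ug] UC].
have FtoB : F (toF @^-1` (toF @` B)) by apply: filterS FB => u Bu; exists u.
have [_ [[u Bu <-] Uu]] := clg _ _ FtoB (open_nbhs_nbhs (conj oU Ug)).
by exists u; split=> //; exact: UC.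
Qed.

End DualBall.

(** * Convex sets and the distance to a set *)

Lemma convex_setE (R : numDomainType) (V : lmodType R) (A : set V) :
  convex_set A <->
  forall x y (t : R), 0 <= t <= 1 -> A x -> A y -> A (t *: x + (1 - t) *: y).
Proof.
split=> [cA x y t /andP[t0 t1] Ax Ay|cA x y t /set_mem Ax /set_mem Ay].
  by have /set_mem := cA x y (Itv01 t0 t1) (mem_set Ax) (mem_set Ay).
by apply/mem_set/cA; rewrite ?ge0 ?le1.
Qed.

Section Distance.
Context {R : realType} {X : normedModType R}.
Implicit Types (D : set X) (x y : X).

Lemma dist_le D x y : D y -> dist x D <= `|y - x|.
Proof. by move=> Dy; apply: ge_inf; [exists 0 => _ [z _ <-]|exists y]. Qed.

Lemma dist_lt D x (r : R) : D !=set0 -> dist x D < r ->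
  exists2 y, D y & `|y - x| < r.
Proof.
move=> [y0 Dy0] /inf_lt[|_ [y Dy <-] yr]; last by exists y.
by exists `|y0 - x|, y0.
Qed.

Lemma dist_ge0 D x : 0 <= dist x D.
Proof.
(* The infimum of the empty set defaults to 0. *)
have [->|/set0P[y0 Dy0]] := eqVneq D set0.
  by rewrite /dist image_set0 inf0.
by apply: lb_le_inf => [|_ [y _ <-]//]; exists `|y0 - x|, y0.
Qed.

Lemma dist_triangle D x y : D !=set0 -> dist x D <= dist y D + `|x - y|.
Proof.
move=> D0; apply/ler_addgt0Pr => e e0.
have [z Dz yz] : exists2 z, D z & `|z - y| < dist y D + e.
  by apply: dist_lt => //; rewrite ltrDl.
apply: le_trans (dist_le x Dz) _; rewrite -(subrK y z) -addrA.
by apply: le_trans (ler_normD _ _) _; rewrite (distrC y x); lra.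
Qed.

End Distance.

(** * Adjusted sublevel sets and their stability *)

Section AdjustedSublevel.
Context {R : realType} {X : normedModType R} (f : X -> \bar R).
Implicit Types (x y : X) (u : dual X).

Lemma argminPn x : ~ argmin f x -> strict_sublevel f (f x) !=set0.
Proof. by move=> /existsNP[y /negP]; rewrite -ltNge => fyx; exists y. Qed.

Lemma adjusted_sublevelE x : ~ argmin f x ->
  adjusted_sublevel f x = [set y | (f y <= f x)%E /\
    dist y (strict_sublevel f (f x)) <= dist x (strict_sublevel f (f x))].
Proof. by move=> xm; rewrite /adjusted_sublevel memNset. Qed.

Lemma adjusted_sublevel_strict x y : (f y < f x)%E -> adjusted_sublevel f x y.
Proof.
move=> yx; have xm : ~ argmin f x by move=> /(_ y); rewrite leNgt yx.
rewrite adjusted_sublevelE//; split; first exact: ltW.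
by apply: le_trans (dist_le y yx) _; rewrite subrr normr0 dist_ge0.
Qed.

Hypothesis f_proper : proper_fun f.
Hypothesis f_qcvx : quasiconvex f.

(** The infinite levels give the whole space and, as [f] never takes the value [-oo], the empty
    set. *)
Lemma sublevel_convex (l : \bar R) x y (t : R) : 0 <= t <= 1 ->
  sublevel f l x -> sublevel f l y -> sublevel f l (t *: x + (1 - t) *: y).
Proof.
move=> t01; case: l => [l|_ _|].
- by move=> xl yl; have /convex_setE := @f_qcvx l; apply.
- by rewrite /sublevel /= leey.
- by rewrite /sublevel /= leeNy_eq => /eqP; case: f_proper => /(_ x).
Qed.

(** Both points lie in the sublevel set at the larger of their values, which is still strictly below
    [l]. *)
Lemma strict_sublevel_convex (l : \bar R) x y (t : R) : 0 <= t <= 1 ->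
  strict_sublevel f l x -> strict_sublevel f l y ->
  strict_sublevel f l (t *: x + (1 - t) *: y).
Proof.
move=> t01 xl yl; apply: (@le_lt_trans _ _ (Order.max (f x) (f y))).
  by apply: sublevel_convex; rewrite // /sublevel /= le_max lexx ?orbT.
by rewrite gt_max; apply/andP.
Qed.

Hypothesis f_lsc : lower_semicontinuous f.

Lemma near_lt_lsc (l : \bar R) x :
  (l < f x)%E -> \forall x' \near x, (l < f x')%E.
Proof.
case: l => [l /f_lsc[V xV Vl]||_]; first by apply: filterS xV.
  by rewrite ltNge leey.
by apply: nearW => y; rewrite ltNye; apply/eqP; case: f_proper.
Qed.

(** If [x] is at distance 0 from [S], a point of [S] close to [y] works by lower semicontinuity.
    Otherwise [y] is pushed towards a point of [S], which brings its distance to [S] strictly below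
    [dist x S] and leaves room to move [x]. *)
Lemma adjusted_sublevel_near x y (e : R) : ~ argmin f x ->
  adjusted_sublevel f x y -> 0 < e ->
  exists2 y', `|y' - y| < e & \forall x' \near x, adjusted_sublevel f x' y'.
Proof.
move=> xm; rewrite adjusted_sublevelE//=; set S := strict_sublevel f (f x).
move=> [yx yd] e0; have S0 : S !=set0 by exact: argminPn.
have [r0|r_neq0] := eqVneq (dist x S) 0.
  have [s Ss sy] : exists2 s, S s & `|s - y| < e.
    by apply: dist_lt => //; apply: le_lt_trans yd _; rewrite r0.
  exists s => //; apply: filterS (near_lt_lsc Ss) => x'.
  exact: adjusted_sublevel_strict.
have r0 : 0 < dist x S by rewrite lt_neqAle eq_sym r_neq0 dist_ge0.
set r := dist x S in yd r0 *.
have [s0 Ss0] := S0.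
(* This [t] makes [t |s0 - y| < e]; the added 1 allows [s0 = y]. *)
pose t := Num.min 1 (e / (2 * (`|s0 - y| + 1))).
have n0 : 0 < `|s0 - y| + 1 by rewrite ltr_wpDl.
have t0 : 0 < t by rewrite lt_min ltr01 divr_gt0// mulr_gt0.
have t1 : t <= 1 by rewrite ge_min lexx.
have t01 : 0 <= t <= 1 by rewrite ltW.
have tn : t * `|s0 - y| < e.
  have : t <= e / (2 * (`|s0 - y| + 1)) by rewrite ge_min lexx orbT.
  by rewrite ler_pdivlMr ?mulr_gt0//; nra.
exists (t *: s0 + (1 - t) *: y).
  rewrite scalerBl scale1r addrCA addrAC subrr add0r -scalerBr normrZ.
  by rewrite gtr0_norm.
(* The slack [t r] is affordable because [(1 - t) (1 + t) r < r]. *)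
have [s Ss sy] : exists2 s, S s & `|s - y| < r + t * r.
  by apply: dist_lt => //; apply: le_lt_trans yd _; rewrite ltrDl mulr_gt0.
set y' := t *: s0 + (1 - t) *: y; set s' := t *: s0 + (1 - t) *: s.
have Ss' : S s' by exact: strict_sublevel_convex.
have y'x : (f y' <= f x)%E by apply: sublevel_convex => //; exact: ltW.
have s'y' : `|s' - y'| < r.
  rewrite /s' /y' opprD addrACA subrr add0r -scalerBr normrZ.
  rewrite ger0_norm ?subr_ge0//.
  have : (1 - t) * `|s - y| <= (1 - t) * (r + t * r).
    by rewrite ler_wpM2l ?subr_ge0// ltW.
  by have := mulr_gt0 (mulr_gt0 t0 t0) r0; nra.
have d0 : 0 < r - `|s' - y'| by rewrite subr_gt0.
near=> x'; have xx' : `|x - x'| < r - `|s' - y'|.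
  by near: x'; exact: cvgr_dist_lt.
(* If [f x' < f x], then [x'] is in [S], too close to [x]. If [f x' > f x], then [y'] is strictly
   below [f x']. If they are equal, [S] is unchanged and [dist x' S] still exceeds [|s' - y'|]. *)
have [x'x|xx'f] := ltP (f x') (f x).
  have := @dist_le _ _ S x x' x'x; rewrite -/r distrC.
  have := normr_ge0 (s' - y'); lra.
have y'x' := le_trans y'x xx'f.
have [x'm|x'm] := pselect (argmin f x').
  by rewrite /adjusted_sublevel mem_set.
move: xx'f; rewrite le_eqVlt => /predU1P[fxx'|fxx']; last first.
  by apply: adjusted_sublevel_strict; exact: le_lt_trans fxx'.
rewrite adjusted_sublevelE//; split => //; rewrite -fxx' -/S.
have := @dist_triangle _ _ S x x' S0; rewrite -/r.
have := dist_le y' Ss'; lra.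
Unshelve. all: by end_near. Qed.

End AdjustedSublevel.

(** * Separation of a point from a convex set with interior *)

Lemma convex_cone_tangent (R : realFieldType) (V : lmodType R) (C : set V)
    (x : V) : convex_set C -> C !=set0 ->
  convex_cone [set v | exists t y, [/\ 0 <= t, C y & v = t *: (y - x)]].
Proof.
move=> /convex_setE cC [y0 Cy0]; split.
- by exists 0, y0; rewrite lexx scale0r.
- move=> _ _ [t [y [t0 Cy ->]]] [s [w [s0 Cw ->]]].
  have [ts0|ts_neq0] := eqVneq (t + s) 0.
    have [-> ->] : t = 0 /\ s = 0 by split; apply/eqP; lra.
    by exists 0, y0; rewrite lexx !scale0r addr0.
  have ts0 : 0 < t + s by rewrite lt_neqAle eq_sym ts_neq0 addr_ge0.
  (* The sum is [t + s] times the offset from [x] of the weighted mean of [y] and [w]. *)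
  pose k := t / (t + s).
  have k01 : 0 <= k <= 1.
    by rewrite divr_ge0 ?(ltW ts0)//= ler_pdivrMr// mul1r lerDl.
  exists (t + s), (k *: y + (1 - k) *: w); split; [exact: ltW|exact: cC|].
  have tk : (t + s) * k = t by rewrite mulrC divfK.
  have -> : k *: y + (1 - k) *: w - x = k *: (y - x) + (1 - k) *: (w - x).
    by rewrite !scalerBr addrACA -opprD -scalerDl [k + _]addrC subrK scale1r.
  by rewrite [RHS]scalerDr !scalerA mulrBr mulr1 tk [t + s]addrC addrK.
- move=> k _ k0 [t [y [t0 Cy ->]]]; exists (k * t), y.
  by rewrite mulr_ge0// scalerA.
Qed.

(** Cone separation is applied to the cone generated by [C - x], with [e = x - z]. *)
Lemma convex_separation (R : realType) (X : normedModType R) (C : set X)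
    (z x : X) (r : R) : convex_set C -> 0 < r ->
    (forall v, `|v| <= r -> C (z + v)) -> ~ C x ->
  exists u : dual X, (forall y, C y -> u (y - x) <= 0) /\ 0 < u (x - z).
Proof.
move=> cC r0 zC Cx; have Cz : C z.
  by rewrite -[z]addr0; apply: zC; rewrite normr0 ltW.
have cP := convex_cone_tangent x cC (ex_intro _ z Cz).
have [|[t [y [t0 Cy xzE]]]|u [uP ue]] :=
  convex_cone_separation (e := x - z) cP r0.
- move=> v vr; exists 1, (z + v); split=> //; first exact: zC.
  by rewrite scale1r opprB addrCA addrA.
(* If [x - z = t (y - x)], then [x = (z + t y) / (1 + t)] would lie in [C]. *)
- have t1 : 0 < 1 + t by rewrite ltr_pwDl.
  apply: Cx; have -> : x = (1 + t)^-1 *: z + (1 - (1 + t)^-1) *: y.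
    have -> : 1 - (1 + t)^-1 = (1 + t)^-1 * t by field; rewrite gt_eqF.
    have xE : x = z + t *: (y - x) by rewrite -xzE addrC subrK.
    rewrite -scalerA -scalerDr.
    have <- : (1 + t) *: x = z + t *: y.
      by rewrite scalerDl scale1r {1}xE scalerBr -addrA subrK.
    by rewrite scalerA mulVf ?scale1r// gt_eqF.
  have /convex_setE := cC; apply => //.
  by rewrite invr_ge0 (ltW t1) invf_le1//= lerDl.
- by exists u; split=> // y Cy; apply: uP; exists 1, y; rewrite ler01 scale1r.
Qed.

(** * Evaluations and weak* half-spaces *)

Lemma dualZE (R : realType) (X : normedModType R) (a : R) (u : dual X) (v : X) :
  (a *: u) v = a * u v.
Proof. by []. Qed.

Lemma dual_funZ (R : realType) (X : normedModType R) (u : dual X) (a : R)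
    (v : X) : u (a *: v) = a * u v.
Proof. exact: linearZ. Qed.

Lemma dualDE (R : realType) (X : normedModType R) (u w : dual X) (v : X) :
  (u + w) v = u v + w v.
Proof. by []. Qed.

Lemma closed_dual_ge (R : realType) (X : normedModType R) (v : X) (c : R) :
  closed [set u : dual X | c <= u v].
Proof.
apply: (@preimage_closed _ _ (fun u : dual X => u v : R) [set r | c <= r]).
  by move=> u _; exact: continuous_dual_eval.
exact: closed_ge.
Qed.

Lemma near_dual_gt (R : realType) (X : normedModType R) (u : dual X) (v : X)
    (c : R) : c < u v -> nbhs u [set u' : dual X | c < u' v].
Proof.
move=> cu; apply: (@continuous_dual_eval R X v u [set r : R | c < r]).
exact: lt_nbhsr.
Qed.

(** * The base of the normal cone *)

Section NormalBase.
Context {R : realType} {X : normedModType R} (f : X -> \bar R).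
Implicit Types (x y z : X) (u : dual X).

Definition normal_base x : set (dual X) :=
  [set u | [/\ dual_unit_ball u, adjusted_normal f x u
    & forall z (r l : R), 0 <= r -> (l%:E < f x)%E ->
      (forall v, `|v| <= 1 -> sublevel f l%:E (z + r *: v)) -> r <= u (x - z)]].

Hypothesis f_proper : proper_fun f.
Hypothesis f_qcvx : quasiconvex f.
Hypothesis f_lsc : lower_semicontinuous f.

(* Separates [x] from the open neighborhood of radius [dist x S] of the strict
   sublevel set [S], or from [S] itself when that radius is zero. *)
Lemma adjusted_normal_neq0 x z (r l : R) : ~ argmin f x -> 0 < r ->
  (l%:E < f x)%E -> (forall v, `|v| <= r -> sublevel f l%:E (z + v)) ->
  exists2 u, adjusted_normal f x u & u <> 0.
Proof.
move=> xm r0 lx zl; set S := strict_sublevel f (f x); set d := dist x S.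
have d0 : 0 <= d by exact: dist_ge0.
have Sz v : `|v| <= r -> S (z + v) by move=> /zl/le_lt_trans; exact.
have Sz0 : S z by rewrite -[z]addr0; apply: Sz; rewrite normr0 ltW.
(* Scaling by [d] covers both cases at once: [G] is [S] when [d = 0]. *)
pose G := [set y | exists s w, [/\ S s, `|w| < 1 & y = s + d *: w]].
have cG : convex_set G.
  apply/convex_setE => _ _ t t01 [s [w [Ss w1 ->]]] [s' [w' [Ss' w'1 ->]]].
  exists (t *: s + (1 - t) *: s'), (t *: w + (1 - t) *: w').
  split; first exact: strict_sublevel_convex.
    set m := Num.max `|w| `|w'|; have m1 : m < 1 by rewrite gt_max w1.
    have wm : `|w| <= m by rewrite le_max lexx.
    have w'm : `|w'| <= m by rewrite le_max lexx orbT.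
    apply: le_lt_trans m1; apply: le_trans (ler_normD _ _) _.
    by case/andP: t01 => t0 t1; rewrite !normrZ !ger0_norm ?subr_ge0//; nra.
  by rewrite !scalerDr addrACA !scalerA ![d * _]mulrC.
have zG v : `|v| <= r -> G (z + v).
  by move=> /Sz Sv; exists (z + v), 0; rewrite normr0 ltr01 scaler0 addr0.
have Gx : ~ G x.
  move=> [s [w [Ss w1 xE]]]; have [d_eq0|d_neq0] := eqVneq d 0.
    by move: Ss; rewrite /S /strict_sublevel /= xE d_eq0 scale0r addr0 ltxx.
  have := dist_le x Ss; rewrite -/d {1}xE opprD addrA subrr add0r normrN.
  apply/negP; rewrite -ltNge normrZ ger0_norm// gtr_pMr//.
  by rewrite lt_neqAle eq_sym d_neq0.
have [u [uG ue]] := convex_separation cG r0 zG Gx.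
exists u; last by move=> u0; move: ue; rewrite u0 ltxx.
move=> y; rewrite adjusted_sublevelE//= -/S -/d => -[_ yd].
(* A point at distance exactly [d] may lie outside [G]. It is reached up to [h *: w], with [h]
   chosen so that [h ||u|| <= e]; the added 1 keeps the denominator positive. *)
apply/ler_addgt0Pr => e e0; rewrite add0r.
have n1 : 0 < dual_norm u + 1 by rewrite ltr_wpDl// dual_norm_ge0.
pose h := e / (dual_norm u + 1).
have h0 : 0 < h by rewrite divr_gt0.
have [s Ss sy] : exists2 s, S s & `|s - y| < d + h.
  by apply: dist_lt; [exists z|apply: le_lt_trans yd _; rewrite ltrDl].
have dh : 0 < d + h by rewrite ltr_wpDl.
pose w := (d + h)^-1 *: (y - s).
have w1 : `|w| < 1.
  rewrite normrZ gtr0_norm ?invr_gt0// mulrC ltr_pdivrMr// mul1r.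
  by rewrite distrC.
have us : u (s + d *: w - x) <= 0 by apply: uG; exists s, w.
have -> : y - x = (s + d *: w - x) + h *: w.
  rewrite [RHS]addrAC -[s + _ + _]addrA -scalerDl scalerA divff ?gt_eqF//.
  by rewrite scale1r [s + _]addrC subrK.
rewrite linearD -[leRHS]add0r lerD//.
have uw : u w <= dual_norm u.
  apply: le_trans (ler_norm _) _; apply: le_trans (ler_dual_norm u w) _.
  by rewrite ler_piMr ?dual_norm_ge0// ltW.
have hu : h * u w <= h * dual_norm u by apply: ler_wpM2l => //; exact: ltW.
rewrite /= dual_funZ; apply: le_trans hu _.
by rewrite /h mulrAC ler_pdivrMr// mulrDr mulr1 lerDl ltW.
Qed.


(** For [v] in the unit ball, [z + r v] lies strictly below level [f x], so normality gives
    [r u(v) <= u(x - z)]; then take the supremum over [v]. *)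
Lemma normal_base_normalize x u : adjusted_normal f x u -> 0 < dual_norm u ->
  normal_base x ((dual_norm u)^-1 *: u).
Proof.
move=> ux n0; have nV0 : 0 < (dual_norm u)^-1 by rewrite invr_gt0.
split.
- apply/dual_unit_ballP => v; rewrite dualZE normrM gtr0_norm//.
  by rewrite ler_pdivrMl// ler_dual_norm.
- by move=> y /ux uy; rewrite dualZE pmulr_rle0.
move=> z r l r0 lx zl; rewrite dualZE ler_pdivlMl//.
have uz v : `|v| <= 1 -> r * u v <= u (x - z).
  move=> /zl zv; have : u (z + r *: v - x) <= 0.
    by apply/ux/adjusted_sublevel_strict; exact: le_lt_trans lx.
  rewrite (_ : _ - x = r *: v - (x - z)); last by rewrite opprB addrCA addrA.
  by rewrite linearB/= dual_funZ subr_le0.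
move: r0; rewrite le_eqVlt => /predU1P[r0|r0].
  by have := uz 0; rewrite -r0 mulr0 mul0r normr0; apply.
rewrite -ler_pdivlMr//; apply: dual_norm_le => v v1.
rewrite ler_pdivlMr// mulrC -[r]gtr0_norm// -normrM ler_norml uz// andbT.
by rewrite lerNl -mulrN -linearN uz// normrN.
Qed.

(** This is closedness of the graph. The bound [||u'|| <= 1] controls [u' (x - x')] uniformly, so
    the pairing is jointly continuous although [u'] varies only in the weak* topology. *)
Lemma normal_base_near x u : ~ argmin f x -> dual_unit_ball u ->
  ~ normal_base x u ->
  \forall u' \near u & x' \near x, ~ normal_base x' u'.
Proof.
move=> xm u1 ux.
have [uN|] := pselect (adjusted_normal f x u); last first.
  move=> /existsNP[y /not_implyP[yx /negP]]; rewrite -ltNge => c0.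
  (* As [|u (y' - y)| <= |y' - y|], half of the gap keeps [u (y' - x)] positive. *)
  have c2 : 0 < u (y - x) / 2 by rewrite divr_gt0.
  have [y' y'y y'x] := adjusted_sublevel_near f_proper f_qcvx f_lsc xm yx c2.
  have uy' : 0 < u (y' - x).
    have -> : u (y' - x) = u (y - x) + u (y' - y).
      by rewrite -linearD/= [y - x + _]addrC addrA subrK.
    move/dual_unit_ballP : u1 => /(_ (y' - y))/le_lt_trans/(_ y'y).
    by rewrite ltr_norml => /andP[]; lra.
  set c := u (y' - x) in uy'.
  have c'0 : 0 < c / 2 by rewrite divr_gt0.
  near=> u' x' => -[/dual_unit_ballP u'1 u'N _].
  have u'c : c / 2 < u' (y' - x).
    by near: u'; apply: near_dual_gt; rewrite -/c; lra.
  have xx' : `|x - x'| < c / 2 by near: x'; exact: cvgr_dist_lt.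
  have /u'N : adjusted_sublevel f x' y' by near: x'.
  rewrite (_ : y' - x' = (y' - x) + (x - x')) ?addrA ?subrK// linearD/=.
  move: (u'1 (x - x')) => /le_lt_trans/(_ xx'); rewrite ltr_norml => /andP[].
  by lra.
have [z [r [l [r0 lx zl ur]]]] : exists z (r l : R), [/\ 0 <= r, (l%:E < f x)%E,
    forall v, `|v| <= 1 -> sublevel f l%:E (z + r *: v) & u (x - z) < r].
  apply: contrapT => H; apply: ux; split=> // z r l r0 lx zl.
  by rewrite leNgt; apply/negP => ur; apply: H; exists z, r, l.
set c := u (x - z) in ur.
have rc0 : 0 < (r - c) / 2 by rewrite divr_gt0// subr_gt0.
near=> u' x' => -[/dual_unit_ballP u'1 _ /(_ z r l r0)].
have lx' : (l%:E < f x')%E by near: x'; exact: near_lt_lsc.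
move=> /(_ lx' zl).
(* The gap between [c] and [r] is split in halves, one for moving [u] and one for moving [x]. *)
have u'c : - ((r + c) / 2) < u' (z - x).
  near: u'; apply: near_dual_gt; rewrite -opprB linearN/= -/c; lra.
have xx' : `|x - x'| < (r - c) / 2.
  near: x'; exact: cvgr_dist_lt.
rewrite distrC in xx'.
rewrite (_ : x' - z = (x' - x) - (z - x)) ?opprB ?addrA ?subrK// linearB/=.
move: (u'1 (x' - x)) => /le_lt_trans/(_ xx'); rewrite ltr_norml => /andP[].
by lra.
Unshelve. all: by end_near. Qed.

(** Normality and the ball constraints cut out an intersection of weak* closed half-spaces inside
    the compact dual ball. *)
Lemma compact_normal_base x : compact (normal_base x).
Proof.
pose C := [set u : dual X | adjusted_normal f x u
    /\ forall z (r l : R), 0 <= r -> (l%:E < f x)%E ->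
      (forall v, `|v| <= 1 -> sublevel f l%:E (z + r *: v)) -> r <= u (x - z)].
have -> : normal_base x = dual_unit_ball `&` C.
  by apply/seteqP; split=> [u [? ? ?]|u [? []]]; split.
apply: compact_closedI; first exact: compact_dual_unit_ball.
have in_closed (v : X) (c : R) (u : dual X) :
    C `<=` [set u | c <= u v] -> closure C u -> c <= u v.
  move=> /closure_subset CS /CS.
  by rewrite -(closure_id _).1//; exact: closed_dual_ge.
move=> u Cu; split=> [y yx|z r l r0 lx zl].
  rewrite -opprB linearN oppr_le0; apply: in_closed Cu => w [wN _] /=.
  by rewrite -opprB linearN oppr_ge0; exact: wN.
by apply: in_closed Cu => w [_ wz]; exact: wz lx zl.
Qed.

Lemma convex_normal_base x : convex_set (normal_base x).
Proof.
apply/convex_setE => u w t /andP[t0 t1] [/dual_unit_ballP u1 uN ux].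
move=> [/dual_unit_ballP w1 wN wx]; have t1' : 0 <= 1 - t by rewrite subr_ge0.
have conv_le (a b c : R) : a <= c -> b <= c -> t * a + (1 - t) * b <= c by nra.
split.
- apply/dual_unit_ballP => v; rewrite dualDE !dualZE.
  apply: le_trans (ler_normD _ _) _.
  rewrite !normrM (ger0_norm t0) (ger0_norm t1').
  by apply: conv_le; [exact: u1|exact: w1].
- by move=> y yx; rewrite dualDE !dualZE; apply: conv_le; [exact: uN|exact: wN].
- move=> z r l r0 lx zl; rewrite dualDE !dualZE -lerN2 opprD -!mulrN.
  by apply: conv_le; rewrite lerN2; [exact: ux zl|exact: wx zl].
Qed.

Hypothesis f_int : forall x, ~ argmin f x ->
  exists2 l : R, (l%:E < f x)%E & (sublevel f l%:E)° !=set0.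

Lemma cone_base_normal_base x : ~ argmin f x ->
  cone_base (normal_base x) (adjusted_normal f x).
Proof.
move=> xm; have [l lx [z zl]] := f_int xm.
have [r r0 zr] : exists2 r : R, 0 < r &
    forall v, `|v| <= r -> sublevel f l%:E (z + v).
  move: zl; rewrite /interior => /nbhs_ballP[e /= e0 ze].
  exists (e / 2); first by rewrite divr_gt0.
  move=> v ve; apply: ze; rewrite -ball_normE /= opprD addrA subrr add0r normrN.
  by apply: le_lt_trans ve _; lra.
have norm_gt0 u : u <> 0 -> 0 < dual_norm u.
  move=> u0; rewrite lt_neqAle dual_norm_ge0 andbT; apply/eqP => n0; apply: u0.
  apply/val_inj/funext => v; apply/eqP; rewrite -normr_le0.
  by rewrite (le_trans (ler_dual_norm u v))// -n0 mul0r.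
have coneN : cone (adjusted_normal f x).
  by move=> u t uN t0 y /uN uy; rewrite dualZE pmulr_rle0.
split => //; first by move=> u [].
- exact: convex_normal_base.
- apply/seteqP; split=> [u uN|_ [t [u [t0 [_ uN _] ->]]]]; last first.
    by move=> y /uN uy; rewrite dualZE mulr_ge0_le0.
  have [->|/eqP u0] := eqVneq u 0.
    (* Writing 0 as a multiple of a base element requires the base to be nonempty. *)
    have [w wN w0] := adjusted_normal_neq0 xm r0 lx zr.
    exists 0, ((dual_norm w)^-1 *: w); rewrite scale0r; split => //.
    by apply: normal_base_normalize => //; exact: norm_gt0.
  exists (dual_norm u), ((dual_norm u)^-1 *: u); split.
  + exact: dual_norm_ge0.
  + by apply: normal_base_normalize => //; exact: norm_gt0.
  + by rewrite scalerA divff ?scale1r// gt_eqF// norm_gt0.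
(* One ball of positive radius puts the base in a weak* closed half-space that misses 0. *)
- have : normal_base x `<=` [set u | r <= u (x - z)].
    move=> u [_ _]; apply; [exact: ltW|exact: lx|].
    move=> v v1; apply: zr; rewrite normrZ gtr0_norm//.
    by rewrite ler_piMr// ltW.
  move=> /closure_subset sub /sub.
  rewrite -(closure_id _).1; last exact: closed_dual_ge.
  by apply/negP; rewrite -ltNge.
Qed.

(** Tube argument: the part of the dual ball outside [O] is compact, and each of its points has,
    together with [x], a product neighborhood off the graph. Compactness yields one neighborhood of
    [x] that serves them all. *)
Lemma upper_semicontinuous_normal_base :
  upper_semicontinuous_on (~` argmin f) normal_base.
Proof.
move=> x xm O oO xO.
have cK : compact (dual_unit_ball `&` ~` O : set (dual X)).
  apply: compact_closedI; first exact: compact_dual_unit_ball.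
  exact: open_closedC.
move/compact_near_coveringP : cK => cK.
have : nbhs x [set x' | dual_unit_ball `&` ~` O `<=` ~` normal_base x'].
  apply: (cK _ _ (fun x' u' => ~ normal_base x' u')) => u [u1 uO].
  by apply: normal_base_near => // /xO.
apply: filterS => x' sub _ u ux'; apply: contrapT => uO.
by apply: (sub u) => //; split => //; case: ux'.
Qed.

End NormalBase.

Theorem theorem3 (R : realType) (X : completeNormedModType R)
    (f : X -> \bar R) (f_proper : proper_fun f) (f_qcvx : quasiconvex f)
    (f_lsc : lower_semicontinuous f)
    (f_int : forall x : X, (~` argmin f) x ->
      exists2 l : R, (l%:E < f x)%E & (sublevel f l%:E)° !=set0) :
  exists A : X -> set (dual X),
    [/\ upper_semicontinuous_on (~` argmin f) A,
        forall x : X, (~` argmin f) x -> A x `<=` dual_unit_ball &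
        forall x : X, (~` argmin f) x ->
          compact (A x) /\ cone_base (A x) (adjusted_normal f x)].
Proof.
exists (normal_base f); split => [|x _ u []//|x xm].
  exact: upper_semicontinuous_normal_base.
by split; [exact: compact_normal_base|exact: cone_base_normal_base].
Qed.
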